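(* Let $d\ge2$, $L\ge2$, let $q=(q_0,\ldots,q_{d-1})$ be a probability distribution, and suppose $\mathcal{B}^{(\alpha)}=\{|e_j^{(\alpha)}\rangle\}_{j=0}^{d-1}$, $\alpha=1,\ldots,L$, is a set of $L$ mutually equibiased bases (MEBs) associated with $q$ in a $d$-dimensional Hilbert space $\mathcal{H}$, satisfying $\lambda_{\max}(N)<1/(L-1)$. Let $\varrho$ be a quantum state (density matrix) on $\mathcal{H}$, let $p_j^{(\alpha)}=\mathrm{Tr}[\varrho P_j^{(\alpha)}]$ with $P_j^{(\alpha)}=|e_j^{(\alpha)}\rangle\langle e_j^{(\alpha)}|$, and let $H(\mathcal{B}^{(\alpha)}|\varrho)=-\sum_{j=0}^{d-1}p_j^{(\alpha)}\log p_j^{(\alpha)}$ be the Shannon entropy of $\{p_j^{(\alpha)}\}_{j=0}^{d-1}$. Put $$C=f_L(q)\Big[\mathrm{Tr}[\varrho^2]-\frac1d\Big]+\frac Ld,\qquad f_L(q)=1+(L-1)\lambda_{\max}(N),\qquad K=\Big\lfloor\frac{L}{C}\Big\rfloor.$$ Then $$\sum_{\alpha=1}^{L}H(\mathcal{B}^{(\alpha)}|\varrho)\ge[L-KC](K+1)\log(K+1)-[L-(K+1)C]K\log K.$$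
   Context: Mutually equibiased bases: let $\mathcal{H}$ be a $d$-dimensional complex Hilbert space and $q=(q_0,\ldots,q_{d-1})$ a probability distribution. A set of $L$ orthonormal bases $\mathcal{B}^{(\alpha)}=\{|e_k^{(\alpha)}\rangle\}_{k=0}^{d-1}$, $\alpha=1,\ldots,L$, of $\mathcal{H}$ is called a set of mutually equibiased bases (MEBs) associated with $q$ if for every pair $\alpha\neq\beta$ there is a permutation $\sigma$ of $\{0,1,\ldots,d-1\}$ (which may depend on the pair $(\alpha,\beta)$) such that $$\mathrm{Tr}\big[P_k^{(\alpha)}P_l^{(\beta)}\big]=q_{\sigma(k)\oplus\sigma(l)}\qquad\text{for all }k,l\in\{0,\ldots,d-1\},$$ where $P_k^{(\alpha)}=|e_k^{(\alpha)}\rangle\langle e_k^{(\alpha)}|$ and $\oplus$ denotes addition modulo $d$. By convention $\mathcal{B}^{(1)}$ is the standard (computational) basis, and $\sigma$ is taken to be the identity when one of the two bases is the standard basis. The matrix $N$: $N$ is the $(d-1)\times(d-1)$ Hermitian matrix (indices $1,\ldots,d-1$) whose only nonzero entries are on the antidiagonal, $N_{k,d-k}=\sum_{m=0}^{d-1}\omega^{-km}q_m$ for $k=1,\ldots,d-1$, with $\omega=e^{2\pi i/d}$. Define $\lambda_{\max}(N)=\max_k|N_{k,d-k}|$, the maximum taken over $k\in\{1,\ldots,(d-1)/2\}$ if $d$ is odd and over $k\in\{1,\ldots,d/2\}$ if $d$ is even. The convention $0\log0=0$ is used. *)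

(* Defs.v *)
From HB Require Import structures.
From mathcomp Require Import all_boot all_order all_algebra perm fingroup.
From mathcomp Require Import sesquilinear spectral complex.
From mathcomp Require Import reals exp trigo.

Set Implicit Arguments.
Unset Strict Implicit.
Unset Printing Implicit Defensive.

Import Order.TTheory GRing.Theory Num.Theory.
Local Open Scope ring_scope.
Local Open Scope complex_scope.
Local Open Scope sesquilinear_scope.

Definition oplus (d : nat) (i j : 'I_d) : 'I_d :=
  Ordinal (ltn_pmod (i + j) (leq_ltn_trans (leq0n i) (ltn_ord i))).

Section Quantum.
Variables (R : realType) (d : nat).

Definition is_prob_distr (q : 'I_d -> R) : Prop :=
  (forall m, 0 <= q m) /\ \sum_m q m = 1.

(* The Hilbert space is C^d, with kets as column vectors; d
   orthonormal vectors of C^d automatically form a basis. *)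
Definition is_orthonormal_basis (e : 'I_d -> 'cV[R[i]]_d) : Prop :=
  forall k l, ((e k)^t* *m e l) 0 0 = (k == l)%:R.

Definition standard_basis (k : 'I_d) : 'cV[R[i]]_d := delta_mx k 0.

Definition rank1_proj (v : 'cV[R[i]]_d) : 'M[R[i]]_d := v *m v^t*.

(* In the order of R[i], 0 <= z means that z is real and nonnegative. *)
Definition is_density_matrix (rho : 'M[R[i]]_d) : Prop :=
  [/\ rho \is hermsymmx,
      forall v : 'cV[R[i]]_d, 0 <= (v^t* *m rho *m v) 0 0
    & \tr rho = 1].

(* Mutually equibiased bases associated with q. The basis labelled alpha = 1
   in the usual numbering is the one of index 0 in 'I_L. *)
Definition is_MEB (L : nat) (q : 'I_d -> R)
    (B : 'I_L -> 'I_d -> 'cV[R[i]]_d) : Prop :=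
  [/\ forall a, is_orthonormal_basis (B a),
      forall a : 'I_L, a = 0%N :> nat -> B a =1 standard_basis
    & forall a b, a != b ->
        exists s : 'S_d,
          (B a =1 standard_basis \/ B b =1 standard_basis -> s = 1%g) /\
          forall k l,
            \tr (rank1_proj (B a k) *m rank1_proj (B b l)) =
            (q (oplus (s k) (s l)))%:C].

Definition omega : R[i] :=
  (cos (2 * pi / d%:R)) +i* (sin (2 * pi / d%:R)).

(* The row of index k : 'I_(d.-1) is the one numbered k.+1 in 1, ..., d - 1,
   and likewise for columns. *)
Definition Nmx (q : 'I_d -> R) : 'M[R[i]]_(d.-1) :=
  \matrix_(k, l)
    if (k.+1 + l.+1 == d)%N
    then \sum_(m < d) omega ^- (k.+1 * m)%N * (q m)%:C
    else 0.

(* rev_ord k : 'I_(d.-1) is the column numbered d - k.+1, and d./2 is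
   (d - 1) / 2 for odd d and d / 2 for even d. The seed 0 of the maximum is
   harmless: the entries are moduli, and the range is nonempty for d >= 2. *)
Definition lambda_max (q : 'I_d -> R) : R :=
  \big[Num.max/0]_(k < d.-1 | (k.+1 <= d./2)%N)
    complex.Re `|Nmx q k (rev_ord k)|.

Definition fL (L : nat) (q : 'I_d -> R) : R := 1 + (L%:R - 1) * lambda_max q.

(* The traces below are real for Hermitian rho; complex.Re only casts them
   from R[i] to R. *)
Definition outcome_prob (rho : 'M[R[i]]_d) (e : 'I_d -> 'cV[R[i]]_d)
    (j : 'I_d) : R :=
  complex.Re (\tr (rho *m rank1_proj (e j))).

Definition purity (rho : 'M[R[i]]_d) : R := complex.Re (\tr (rho *m rho)).

(* Natural logarithm; a null p j contributes 0 * ln 0 = 0. *)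
Definition shannon_entropy (p : 'I_d -> R) : R := - \sum_j p j * ln (p j).

End Quantum.

(* Main.v *)
(** Each entropy is bounded below by an affine function of the index of
coincidence [sum_j p_j^2] (the Harremoes-Topsoe inequality): on the simplex,
[sum_j (- p_j ln p_j + b p_j^2)] is at least its value at some uniform
distribution, because replacing two entries by their sum or by their average
never increases it (for one of the two choices), until all entries lie where
the summand is convex. It remains to bound the total index of coincidence.
With [x_j^a = p_j^a - 1/d], [S = sum_(a, j) x_j^a P_j^a] and
[T = sum_(a, j) (x_j^a)^2], we have [tr (rho S) = T], and
[tr (rho - 1/d - S / f_L)^2 >= 0] gives [T <= f_L (tr rho^2 - 1/d)] as soon as
[tr S^2 <= f_L T]. The cross terms of [tr S^2] are bilinear forms
[sum_(k, l) x_k y_l q_(k (+) l)] on sum-zero vectors, which the Fourier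
transform diagonalizes with multipliers the entries of [N]. *)

Require Import Defs.
From HB Require Import structures.
From mathcomp Require Import all_boot all_order all_algebra perm fingroup.
From mathcomp Require Import sesquilinear spectral complex.
From mathcomp Require Import reals exp trigo.
From mathcomp Require Import archimedean classical_sets topology normedtype.
From mathcomp Require Import derive realfun zify ring lra.

Set Implicit Arguments.
Unset Strict Implicit.
Unset Printing Implicit Defensive.

Import Order.TTheory GRing.Theory Num.Theory.
Import numFieldNormedType.Exports.
Local Open Scope ring_scope.

(** * Mean value theorem for a logarithm plus a rational function *)

Section MeanValue.
Local Open Scope classical_set_scope.
Local Open Scope ring_scope.

(** One family covers both later monotonicity arguments: [D = 0] in [Nln_ge_parabola] and [C = 0] in
    [penalized_ge_tangent]. *)
Lemma MVT_ln (R : realType) (B C D x y : R) : 0 < x -> x <= y ->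
  let F z := - ln z + (B * z + (C * z ^+ 2 + D * z^-1)) in
  exists2 c, x <= c <= y &
    F y - F x = (- c^-1 + (B + (C * (2 * c) - D / c ^+ 2))) * (y - x).
Proof.
move=> x0 xy F.
have dF (z : R) : 0 < z ->
    is_derive z 1 F (- z^-1 + (B + (C * (2 * z) - D / z ^+ 2))).
  move=> z0.
  have z1 := is_derive1_ln z0.
  have z2 := @is_deriveV R id z 1 1 (lt0r_neq0 z0) (is_derive_id z 1).
  have z3 : is_derive z 1 (fun z : R => z ^+ 2) (2 * z).
    by apply: is_derive_eq; rewrite /GRing.scale /=; ring.
  apply: is_derive_eq.
  by rewrite /GRing.scale /=; field; rewrite gt_eqF.
have dFI (z : R) : z \in `]x, y[ ->
    is_derive z 1 F (- z^-1 + (B + (C * (2 * z) - D / z ^+ 2))).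
  rewrite in_itv /= => /andP[xz _]; apply: dF; exact: lt_trans xz.
have cF : {within `[x, y], continuous F}.
  apply: continuous_in_subspaceT => z; rewrite inE /= in_itv /= => /andP[xz _].
  have [/derivable1_diffP dz _] := dF z (lt_le_trans x0 xz).
  exact: differentiable_continuous.
have [c cI Hc] := MVT_segment xy dFI cF.
by exists c; move: cI; rewrite in_itv.
Qed.

End MeanValue.

(** * Logarithm inequalities and the entropy of a split mass *)

Section Logarithm.
Variable R : realType.
Implicit Types x y p u : R.

Lemma ln_leB1 x : 0 < x -> ln x <= x - 1.
Proof. by move=> x0; rewrite -{1}[x](subrKC 1) le_ln1Dx //; lra. Qed.

Lemma ln_ge1BV x : 0 < x -> 1 - x^-1 <= ln x.
Proof.
move=> x0; have := @ln_leB1 x^-1; rewrite invr_gt0 lnV ?posrE //.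
by move=> /(_ x0); lra.
Qed.

Lemma ln2_bounds : 1 / 2 <= ln (2 : R) <= 1.
Proof.
by have := @ln_ge1BV 2; have := @ln_leB1 2; lra.
Qed.

(* The tangent at [1/2] of the convex function [- ln u / (1 - u)]. *)
Lemma Nln_ge_parabola u : 0 < u -> u <= 1 ->
  (1 - u) * (2 + 4 * (ln 2 - 1) * u) <= - ln u.
Proof.
move=> u0 u1; have /andP[l1 l2] := ln2_bounds.
set l := ln 2 in l1 l2 *.
pose F z := - ln z + ((6 - 4 * l) * z + (- 4 * (1 - l) * z ^+ 2 + 0 * z^-1)).
(* The claim reads [2 <= F u]. As [1/2 <= l <= 1], [F] decreases up to [1/2], increases while
   [4 (1 - l) z <= 1], and decreases afterwards; so its least value on []0, 1]] is
   [F (1/2) = F 1 = 2]. *)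
pose dF (z : R) := (2 * z - 1) * (1 - 4 * (1 - l) * z) / z.
have FE z y : 0 < z -> z <= y ->
    exists2 c, z <= c <= y & F y - F z = dF c * (y - z).
  move=> z0 zy; have [c cI Hc] := MVT_ln (6 - 4 * l) (- 4 * (1 - l)) 0 z0 zy.
  exists c => //; rewrite [LHS]Hc /dF; congr (_ * _); field.
  by rewrite gt_eqF //; case/andP: cI => /(lt_le_trans z0).
suff: 2 <= F u by rewrite /F; nra.
have F1 : F 1 = 2 by rewrite /F ln1; lra.
have F2 : F (2^-1) = 2 by rewrite /F lnV ?posrE // -/l; lra.
have [uh|uh] := leP u 2^-1.
  have [c /andP[c1 c2] Hc] := FE _ _ u0 uh.
  have c0 := lt_le_trans u0 c1.
  have ? : dF c <= 0.
    rewrite /dF pmulr_lle0 ?invr_gt0 //.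
    by apply: mulr_le0_ge0; nra.
  by nra.
have [uk|uk] := leP (4 * (1 - l) * u) 1.
  have h0 : 0 < 2^-1 :> R by rewrite invr_gt0.
  have [c /andP[c1 c2] Hc] := FE _ _ h0 (ltW uh).
  have c0 : 0 < c by lra.
  have ? : 0 <= dF c.
    rewrite /dF pmulr_lge0 ?invr_gt0 //.
    by apply: mulr_ge0; nra.
  by nra.
have [c /andP[c1 c2] Hc] := FE _ _ u0 u1.
have c0 := lt_le_trans u0 c1.
have ? : dF c <= 0.
  rewrite /dF pmulr_lle0 ?invr_gt0 //.
  by apply: mulr_ge0_le0; nra.
by nra.
Qed.

Definition negxlnx x := - (x * ln x).

Lemma negxlnx0 : negxlnx 0 = 0.
Proof. by rewrite /negxlnx mul0r oppr0. Qed.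

Lemma negxlnx_ge0 p : 0 <= p <= 1 -> 0 <= negxlnx p.
Proof.
move=> /andP[p0 p1]; rewrite oppr_ge0 mulr_ge0_le0 //.
have [->|pN0] := eqVneq p 0; first by rewrite ln0.
by have := @ln_leB1 p; rewrite lt_def pN0 p0 => /(_ isT); lra.
Qed.

(* Equality holds at [x = y] as well as at [x y = 0], so the constant [4 ln 2]
   gives merging and averaging the same threshold in
   [penalized_merge_or_average]. *)
Lemma negxlnx_split x y : 0 <= x -> 0 <= y -> 0 < x + y ->
  negxlnx (x + y) + 4 * ln 2 * (x * y) / (x + y) <= negxlnx x + negxlnx y.
Proof.
rewrite le0r => /orP[/eqP ->|x0].
  by rewrite negxlnx0 !(mul0r, mulr0, add0r, addr0).
rewrite le0r => /orP[/eqP ->|y0 c0].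
  by rewrite negxlnx0 !(mul0r, mulr0, add0r, addr0).
set c := x + y in c0 *; pose u := x / c; pose v := y / c.
have cN0 : c != 0 by rewrite gt_eqF.
have uv : u + v = 1 by rewrite /u /v -mulrDl divff.
have u0 : 0 < u by rewrite divr_gt0.
have v0 : 0 < v by rewrite divr_gt0.
have Hu := Nln_ge_parabola u0 _; have Hv := Nln_ge_parabola v0 _.
have xE : x = c * u by rewrite /u mulrC divfK.
have yE : y = c * v by rewrite /v mulrC divfK.
have lx : ln x = ln c + ln u by rewrite xE lnM.
have ly : ln y = ln c + ln v by rewrite yE lnM.
have -> : 4 * ln 2 * (x * y) / c = c * (4 * ln 2 * (u * v)).
  by rewrite xE yE; field.
have -> : negxlnx x + negxlnx y = negxlnx c + c * (u * - ln u + v * - ln v).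
  rewrite /negxlnx lx ly xE yE.
  have -> : v = 1 - u by lra.
  by ring.
rewrite lerD2l ler_pM2l //.
(* As [u + v = 1], the two parabolas weighted by [u] and [v] add up to
   [u v (4 + 4 (ln 2 - 1)) = 4 ln 2 u v]. *)
have {}Hu := ler_wpM2l (ltW u0) (Hu _); have {}Hv := ler_wpM2l (ltW v0) (Hv _).
apply: le_trans (lerD (Hu _) (Hv _)); try lra.
have -> : v = 1 - u by lra.
by rewrite le_eqVlt; apply/orP; left; apply/eqP; ring.
Qed.
End Logarithm.

(** * Entropy against the index of coincidence *)

Section Entropy.
Variable R : realType.
Implicit Types x y b p m : R.

(** Here [b] acts as a Lagrange multiplier for the index of coincidence. The second derivative
    [2 b - 1/p] is nonnegative exactly when [1 <= 2 b p], the convexity condition recurring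
    below. *)
Definition penalized b p := negxlnx p + b * p ^+ 2.

(** Put [c = x + y > 0] and [g = 2 ln 2 - b c]. By [negxlnx_split], merging lowers the sum by at
    least [(2 x y / c) g], and averaging by at least [(2 x y / c - c / 2) g]. Since
    [x y <= c^2 / 4], the sign of [g] tells which of the two is nonnegative. *)
Lemma penalized_merge_or_average b x y : 0 < b -> 0 <= x -> 0 <= y ->
  if b * (x + y) <= 2 * ln 2
  then penalized b (x + y) <= penalized b x + penalized b y
  else 2 * penalized b ((x + y) / 2) <= penalized b x + penalized b y.
Proof.
move=> b0 x0 y0; have /andP[l1 l2] := ln2_bounds R.
have : 0 <= x + y by lra.
rewrite le0r => /orP[/eqP xy0|c0].
  have [-> ->] : x = 0 /\ y = 0 by split; lra.
  by rewrite addr0 mul0r /penalized negxlnx0 !(mulr0, expr0n, addr0) /=;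
    rewrite lexx if_same.
have := negxlnx_split x0 y0 c0; rewrite /penalized.
set c := x + y in c0 *; set l := ln 2 in l1 l2 *.
set X := 4 * l * (x * y) / c => Hs.
have XE : X - 2 * b * (x * y) = 2 * (x * y) / c * (2 * l - b * c).
  by rewrite /X; field; rewrite gt_eqF.
have xy_ge0 : 0 <= x * y by rewrite mulr_ge0.
have xy_le : x * y <= c ^+ 2 / 4 by rewrite /c; have := sqr_ge0 (x - y); nra.
have cE : c ^+ 2 = x ^+ 2 + y ^+ 2 + 2 * (x * y) by rewrite /c; ring.
case: ifPn => [bc|].
  suff : 0 <= X - 2 * b * (x * y) by nra.
  by rewrite XE mulr_ge0 ?subr_ge0 // divr_ge0 // ?mulr_ge0 // ltW.
rewrite -ltNge => bc.
have -> : negxlnx (c / 2) = c / 2 * l - c / 2 * ln c.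
  by rewrite /negxlnx ln_div ?posrE // -/l; ring.
have H : c / 2 * (2 * l - b * c) <= X - 2 * b * (x * y).
  rewrite XE; apply: ler_wnM2r; first lra.
  by rewrite ler_pdivrMr //; lra.
rewrite /negxlnx in Hs *; nra.
Qed.

(** The tangent at [m] is [p T(m) - D] and [penalized b p] is [p T(p) - D], so it suffices that
    [T m <= T p]. Between [m] and [p] one has [b (z + m) >= 1], so [dT z] has the sign of
    [z - m]. *)
Lemma penalized_ge_tangent b p m : 0 < p -> 0 < m ->
  1 <= 2 * b * p -> 1 <= 2 * b * m ->
  penalized b m + (2 * b * m - ln m - 1) * (p - m) <= penalized b p.
Proof.
move=> p0 m0 bp bm; set D := b * m ^+ 2 - m.
pose T z := - ln z + (b * z + (0 * z ^+ 2 + D * z^-1)).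
pose dT z := (z - m) * (b * (z + m) - 1) / z ^+ 2.
have TE z y : 0 < z -> z <= y ->
    exists2 c, z <= c <= y & T y - T z = dT c * (y - z).
  move=> z0 zy; have [c cI Hc] := MVT_ln b 0 D z0 zy.
  exists c => //; rewrite [LHS]Hc /dT /D; congr (_ * _); field.
  by rewrite gt_eqF //; case/andP: cI => /(lt_le_trans z0).
have Tmp : T m <= T p.
  have [mp|/ltW pm] := leP m p.
    have [c /andP[c1 c2] Hc] := TE _ _ m0 mp.
    rewrite -subr_ge0 Hc mulr_ge0 ?subr_ge0 // divr_ge0 ?sqr_ge0 // mulr_ge0
      //; nra.
  have [c /andP[c1 c2] Hc] := TE _ _ p0 pm.
  rewrite -subr_le0 Hc mulr_le0_ge0 ?subr_ge0 //.
  rewrite mulr_le0_ge0 ?invr_ge0 ?sqr_ge0 // mulr_le0_ge0 //; nra.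
have := ler_wpM2l (ltW p0) Tmp.
have -> : p * T m = p * (2 * b * m - ln m - 1).
  by rewrite /T /D; field; rewrite gt_eqF.
have -> : p * T p = penalized b p + D.
  by rewrite /T /D /penalized /negxlnx; field; rewrite gt_eqF.
rewrite /D /penalized /negxlnx; nra.
Qed.

(** Jensen's inequality by tangents at the mean [1/n]: their linear terms cancel because the entries
    sum to 1, and [n] copies of [penalized b n^-1] make up the left side. *)
Lemma penalized_Jensen b (s : seq R) :
  (forall p, p \in s -> 0 < p /\ 1 <= 2 * b * p) -> \sum_(p <- s) p = 1 ->
  ln (size s)%:R + b / (size s)%:R <= \sum_(p <- s) penalized b p.
Proof.
move=> sP s1; set n := (size s)%:R : R.
have n0 : 0 < n.
  rewrite ltr0n lt0n size_eq0; apply/eqP => s0.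
  by move: s1 (oner_neq0 R); rewrite s0 big_nil => ->; rewrite eqxx.
have nV0 : 0 < n^-1 by rewrite invr_gt0.
have sumc (z : R) : \sum_(p <- s) z = n * z.
  by rewrite big_const_seq count_predT iter_addr_0 mulr_natl.
(* The mean inherits the convexity condition by averaging it over the entries. *)
have bm : 1 <= 2 * b * n^-1.
  have : \sum_(p <- s) 1 <= \sum_(p <- s) 2 * b * p.
    by rewrite big_seq [leRHS]big_seq; apply: ler_sum => p /sP [].
  by rewrite -mulr_sumr s1 sumc !mulr1 ler_pdivlMr // mul1r.
apply: (@le_trans _ _ (\sum_(p <- s) (penalized b n^-1
    + (2 * b * n^-1 - ln n^-1 - 1) * (p - n^-1)))).
  rewrite big_split /= -mulr_sumr sumrB s1 !sumc.
  rewrite /penalized /negxlnx lnV ?posrE //.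
  by rewrite le_eqVlt; apply/orP; left; apply/eqP; field; rewrite gt_eqF.
rewrite big_seq [leRHS]big_seq; apply: ler_sum => p /sP [p0 bp].
exact: penalized_ge_tangent.
Qed.

(** Induction on the length, looking at the two smallest entries. If merging them is favourable, the
    list gets shorter; otherwise averaging them brings every entry into the convex range, where
    [penalized_Jensen] concludes. *)
Lemma penalized_sum_ge_uniform b (s : seq R) : 0 < b ->
  (forall p, p \in s -> 0 <= p) -> \sum_(p <- s) p = 1 ->
  exists2 n, (0 < n)%N & ln n%:R + b / n%:R <= \sum_(p <- s) penalized b p.
Proof.
move=> b0; have /andP[l1 l2] := ln2_bounds R.
have [k] := ubnP (size s); elim: k s => // k IH s sk s0 s1.
have sS := permEl (perm_sort <=%R s).
have sS_sorted : sorted <=%R (sort <=%R s) by apply: sort_sorted => x y;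
  apply: le_total.
rewrite -!(perm_big _ sS) /= in s1 *.
have {}s0 p : p \in sort <=%R s -> 0 <= p by rewrite mem_sort; apply: s0.
rewrite -(perm_size sS) in sk.
move: (sort _ s) s0 s1 sk sS_sorted => [|x [|y t]] s0 s1 sk st.
- by move: s1 (oner_neq0 R); rewrite big_nil => ->; rewrite eqxx.
- exists 1%N => //; move: s1; rewrite !big_seq1 => ->.
  by rewrite /penalized /negxlnx ln1; lra.
have x0 : 0 <= x by apply: s0; rewrite !inE eqxx.
have y0 : 0 <= y by apply: s0; rewrite !inE eqxx orbT.
move: st => /= /andP[xy yt].
have := penalized_merge_or_average b0 x0 y0; case: ifPn => [_ Hm|].
  have [|||n n0 Hn] := IH (x + y :: t).
  - by move: sk => /=; rewrite !ltnS.
  - move=> p; rewrite inE => /orP[/eqP ->|pt]; first exact: addr_ge0.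
    by apply: s0; rewrite !inE pt !orbT.
  - by rewrite -s1 !big_cons addrA.
  exists n => //; apply: le_trans Hn _.
  by rewrite !big_cons addrA lerD2r.
rewrite -ltNge => bxy Hm.
(* Because [2 ln 2 >= 1], the average is in the convex range; so is [y], which is at least the
   average, and then every entry of the sorted tail. *)
have bh : 1 <= 2 * b * ((x + y) / 2) by lra.
have by_ : 1 <= 2 * b * y by nra.
pose s' := [:: (x + y) / 2, (x + y) / 2 & t].
exists (size s') => //.
apply: (@le_trans _ _ (\sum_(p <- s') penalized b p)).
  apply: penalized_Jensen.
    move=> p; rewrite !inE orbA orbb => /orP[/eqP ->|pt]; first by split;
      [nra|].
    have yp : y <= p.
      by move: yt; rewrite path_sortedE;
        [case/andP => /allP /(_ _ pt)|exact: le_trans].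
    by split; nra.
  by rewrite -s1 !big_cons; lra.
by rewrite !big_cons; lra.
Qed.

(** This [b] makes [ln z + b / z] take the same value at [K] and [K + 1], namely the left side. The
    function is least at [z = b], which lies between [K] and [K + 1] by [H1] and [H2], so no integer
    does better. *)
Lemma ln_uniform_bound (K n : nat) : (0 < K)%N -> (0 < n)%N ->
  let b : R := K%:R * K.+1%:R * (ln K.+1%:R - ln K%:R) in
  K.+1%:R * ln K.+1%:R - K%:R * ln K%:R <= ln n%:R + b / n%:R.
Proof.
move=> K0 n0; set k := K%:R : R; set m := n%:R : R.
have kE : K.+1%:R = k + 1 by rewrite -addn1 natrD.
have k0 : 0 < k by rewrite ltr0n.
have m0 : 0 < m by rewrite ltr0n.
rewrite /= !kE; set a := ln (k + 1); set c := ln k;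
  set b := k * (k + 1) * (a - c).
have H1 : 1 <= (k + 1) * (a - c).
  have := @ln_ge1BV R ((k + 1) / k); rewrite ln_div ?posrE ?divr_gt0 //;
    try lra.
  move=> /(_ isT); rewrite invf_div -/a -/c => h.
  rewrite -ler_pdivrMl; last lra.
  by apply: le_trans h; rewrite le_eqVlt; apply/orP; left; apply/eqP; field;
    lra.
have H2 : k * (a - c) <= 1.
  have := @ln_leB1 R ((k + 1) / k); rewrite ln_div ?posrE ?divr_gt0 //; try lra.
  move=> /(_ isT); rewrite -/a -/c => h.
  rewrite -ler_pdivlMl //.
  by apply: le_trans h _; rewrite le_eqVlt; apply/orP; left; apply/eqP; field;
    lra.
have [nK|Kn] := leqP n K.
  have mk : m <= k by rewrite ler_nat.
  have := @ln_ge1BV R (m / k); rewrite ln_div ?posrE ?divr_gt0 // => /(_ isT).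
  rewrite invf_div -/c => h.
  (* After [ln (m / k) >= 1 - k / m], this product is the remaining lower bound on the excess over
     the value at [K]; the case [K < n] compares with [K + 1] likewise. *)
  have : 0 <= (k - m) * (b - k) / (m * k).
    rewrite divr_ge0 ?mulr_ge0 ?subr_ge0 //; try lra.
    by rewrite /b; nra.
  have -> : (k - m) * (b - k) / (m * k) = 1 - k / m + b / m - b / k.
    by field; rewrite !gt_eqF.
  have -> : b / k = (k + 1) * (a - c) by rewrite /b; field; rewrite gt_eqF.
  lra.
have mk : k + 1 <= m by rewrite -kE ler_nat.
have k10 : 0 < k + 1 by lra.
have := @ln_ge1BV R (m / (k + 1));
  rewrite ln_div ?posrE ?divr_gt0 // => /(_ isT).
rewrite invf_div -/a => h.
have : 0 <= (m - (k + 1)) * (k + 1 - b) / (m * (k + 1)).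
  rewrite divr_ge0 ?mulr_ge0 ?subr_ge0 //; try lra.
  by rewrite /b; nra.
have -> : (m - (k + 1)) * (k + 1 - b) / (m * (k + 1)) =
    1 - (k + 1) / m + b / m - b / (k + 1).
  by field; rewrite !gt_eqF.
have -> : b / (k + 1) = k * (a - c) by rewrite /b; field; rewrite gt_eqF.
lra.
Qed.

(** In the plane of index of coincidence and entropy, the bound is the line through the points
    [(1/K, ln K)] and [(1/(K+1), ln (K+1))] of two consecutive uniform distributions. *)
Lemma shannon_entropy_ge_coincidence (d K : nat) (p : 'I_d -> R) :
  (0 < K)%N -> (forall j, 0 <= p j) -> \sum_j p j = 1 ->
  K.+1%:R * ln K.+1%:R - K%:R * ln K%:R
    - K%:R * K.+1%:R * (ln K.+1%:R - ln K%:R) * \sum_j p j ^+ 2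
  <= shannon_entropy p.
Proof.
move=> K0 p0 p1; set b := K%:R * K.+1%:R * _.
have b0 : 0 < b.
  by rewrite !mulr_gt0 ?ltr0n // subr_gt0 ltr_ln ?posrE ?ltr0n // ltr_nat.
have [||n n0 Hn] := @penalized_sum_ge_uniform b (codom p) b0.
- by move=> _ /codomP[j ->].
- by rewrite -p1 big_image.
have := le_trans (ln_uniform_bound K0 n0) Hn.
rewrite big_image /= big_split /= -mulr_sumr /shannon_entropy -sumrN /negxlnx.
lra.
Qed.
End Entropy.

(** * Discrete Fourier transform on the integers modulo [d] *)

Section Fourier.
Local Open Scope complex_scope.
Variables (R : realType) (d : nat).
Hypothesis d_gt0 : (0 < d)%N.
Local Notation w := (omega R d).

Lemma omegaX n : w ^+ n =
  cos (n%:R * (2 * pi / d%:R)) +i* sin (n%:R * (2 * pi / d%:R)).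
Proof.
elim: n => [|n IH]; first by rewrite !mul0r cos0 sin0 expr0.
rewrite exprS IH -[n.+1%:R]natr1 (mulrDl n%:R 1) mul1r /omega cosD sinD.
by apply/eqP; rewrite eq_complex /=; apply/andP; split; apply/eqP; ring.
Qed.

Lemma norm_omegaX n : `|w ^+ n| = 1.
Proof. by rewrite omegaX normc_def /= cos2Dsin2 sqrtr1. Qed.

Lemma omega_prim_root : d.-primitive_root w.
Proof.
have d0 : 0 < d%:R :> R by rewrite ltr0n.
have wd : w ^+ d = 1.
  rewrite omegaX mulrC divfK ?gt_eqF // mulr_natl cos2pi sin2pi.
  by apply/eqP; rewrite eq_complex /= !eqxx.
have [m mprim /(dvdn_leq d_gt0)] := prim_order_exists d_gt0 wd.
rewrite leq_eqVlt => /orP[/eqP mE|md]; first by rewrite -{1}mE.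
have m0 : (0 < m)%N := prim_order_gt0 mprim.
have := prim_expr_order mprim; rewrite omegaX => -[].
(* An order [m < d] would give [cos (2 t) = 1], hence [sin t = 0], although [t] lies strictly
   between 0 and [pi]. *)
pose t : R := m%:R * (pi / d%:R).
have -> : m%:R * (2 * pi / d%:R) = t *+ 2 by rewrite /t; ring.
have st : 0 < sin t.
  apply: sin_gt0_pi; rewrite /t mulr_gt0 ?divr_gt0 ?pi_gt0 ?ltr0n //=.
  rewrite mulrCA -[ltRHS]mulr1 ltr_pM2l ?pi_gt0 // ltr_pdivrMr // mul1r.
  by rewrite ltr_nat.
rewrite cos_mulr2n cos2sin2 -mulr_natl => h _; nra.
Qed.

Lemma conj_omegaX n : (w ^+ n)^* = w ^- n.
Proof. by rewrite invc_norm norm_omegaX expr1n invr1 mul1r. Qed.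

(** A geometric sum of ratio [z = w^i / w^j] with [z^d = 1]; since [w] is primitive, [z = 1] exactly
    when [i] and [j] agree modulo [d], and otherwise [z - 1] can be cancelled. *)
Lemma omega_orthogonality i j :
  \sum_(t < d) w ^+ (t * i) * w ^- (t * j) =
    if (i == j %[mod d]) then d%:R else 0.
Proof.
have wU n : w ^+ n \is a GRing.unit.
  by rewrite unitfE -normr_eq0 norm_omegaX oner_eq0.
pose z := w ^+ i / w ^+ j.
have zE : z ^+ d = 1.
  rewrite expr_div_n -!exprM ![(_ * d)%N]mulnC !exprM.
  by rewrite (prim_expr_order omega_prim_root) !expr1n divr1.
under eq_bigr => t _ do rewrite ![(t * _)%N]mulnC !exprM -expr_div_n -/z.
case: ifPn => [ij|nij].
  have -> : z = 1.
    apply/eqP; rewrite -(inj_eq (mulIr (wU j))) mulrVK // mul1r.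
    by rewrite (eq_prim_root_expr omega_prim_root).
  by under eq_bigr do rewrite expr1n; rewrite sumr_const card_ord.
have z1 : z - 1 != 0.
  rewrite subr_eq0 -(inj_eq (mulIr (wU j))) mulrVK // mul1r.
  by rewrite (eq_prim_root_expr omega_prim_root).
by apply: (mulfI z1); rewrite -subrX1 zE subrr mulr0.
Qed.

Definition dft (x : 'I_d -> R) (t : nat) : R[i] :=
  \sum_(k < d) (x k)%:C * w ^+ (t * k).

(** The sign convention of the entries of [N]. There is no factor [1/d]: on real vectors this is the
    conjugate of [dft], not its inverse. *)
Definition idft (x : 'I_d -> R) (t : nat) : R[i] :=
  \sum_(k < d) w ^- (t * k) * (x k)%:C.

Lemma conj_dft x t : (dft x t)^* = idft x t.
Proof.
rewrite /dft rmorph_sum; apply: eq_bigr => k _ /=.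
by rewrite rmorphM mulrC; congr (_ * _); [apply: conj_omegaX|apply: conjc_real].
Qed.

Lemma dft_parseval x :
  \sum_(t < d) `|dft x t| ^+ 2 = (d%:R * \sum_k x k ^+ 2)%:C.
Proof.
under eq_bigr => t _.
  rewrite sqr_normc conj_dft /dft /idft big_distrlr /=.
  over.
rewrite exchange_big /= rmorphM /= rmorph_sum /= mulr_sumr rmorph_nat.
apply: eq_bigr => k _; rewrite exchange_big (bigD1 k) //=.
rewrite [X in _ + X]big1 ?addr0 => [|l lk].
  under eq_bigr => t _ do rewrite mulrACA mulrAC -mulrA [(x k)%:C * _]mulrC.
  transitivity ((x k)%:C * (x k)%:C *
     \sum_(t < d) w ^+ (t * k) * w ^- (t * k)).
    by rewrite mulr_sumr; apply: eq_bigr => t _; ring.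
  by rewrite omega_orthogonality eqxx rmorphXn /= expr2 mulrC.
transitivity ((x k)%:C * (x l)%:C *
     \sum_(t < d) w ^+ (t * k) * w ^- (t * l)).
  by rewrite mulr_sumr; apply: eq_bigr => t _; ring.
by rewrite omega_orthogonality !modn_small // eq_sym (negPf lk : (l == k :>
  nat) = _) mulr0.
Qed.

(** Once the transforms are expanded, the sum over [t] is [d] when [m] is [oplus k l] and 0
    otherwise, by orthogonality. *)
Lemma dft_convolution (x y q : 'I_d -> R) :
  (d%:R * \sum_k \sum_l x k * y l * q (oplus k l))%:C =
  \sum_(t < d) idft q t * (dft x t * dft y t).
Proof.
transitivity (\sum_k \sum_l \sum_m (x k * y l * q m)%:C *
    \sum_(t < d) w ^+ (t * (k + l)) * w ^- (t * m)).
  rewrite rmorphM rmorph_nat rmorph_sum /= mulr_sumr.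
  apply: eq_bigr => k _; rewrite rmorph_sum /= mulr_sumr.
  apply: eq_bigr => l _; rewrite (bigD1 (oplus k l)) //= [X in _ + X]big1.
    by rewrite omega_orthogonality /= modn_mod eqxx addr0 mulrC.
  move=> m mkl; rewrite omega_orthogonality [X in if X then _ else _](_ : _ =
    false) ?mulr0 //.
  by apply: contraNF mkl => /eqP E; apply/eqP/val_inj; rewrite /= E modn_small.
transitivity (\sum_(t < d) \sum_(k < d) \sum_(l < d) \sum_(m < d)
    w ^- (t * m) * (q m)%:C * ((x k)%:C * w ^+ (t * k) * ((y l)%:C * w ^+ (t *
      l)))).
  rewrite [RHS]exchange_big; apply: eq_bigr => k _ /=.
  rewrite [RHS]exchange_big; apply: eq_bigr => l _ /=.
  rewrite [RHS]exchange_big; apply: eq_bigr => m _ /=.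
  rewrite mulr_sumr; apply: eq_bigr => t _.
  by rewrite mulnDr exprD !rmorphM /=; ring.
apply: eq_bigr => t _; rewrite [dft x t * _]big_distrlr /= mulr_sumr.
apply: eq_bigr => k _; rewrite mulr_sumr; apply: eq_bigr => l _.
by rewrite mulr_suml.
Qed.

End Fourier.

(** * Bilinear forms controlled by the spectrum of [N] *)

Section Spectral.
Local Open Scope complex_scope.
Variables (R : realType) (d : nat).
Hypothesis d_gt0 : (0 < d)%N.
Local Notation w := (omega R d).

Lemma norm_complexR (z : R[i]) : `|z| = (complex.Re `|z|)%:C.
Proof. by rewrite RRe_real ?normr_real. Qed.

Lemma lambda_max_ge0 (q : 'I_d -> R) : 0 <= lambda_max q.
Proof. exact: bigmax_ge_id. Qed.

Lemma norm_idft_le_half (q : 'I_d -> R) t : (0 < t < d)%N -> (t <= d./2)%N ->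
  `|idft q t| <= (lambda_max q)%:C.
Proof.
move=> /andP[t0 td] th; have kd : (t.-1 < d.-1)%N by rewrite -ltnS !prednK.
rewrite norm_complexR lecR.
(* Rows are indexed from 0, so the row numbered [t] has index [t.-1]; its antidiagonal entry is
   [idft q t]. *)
apply: (@bigmax_sup _ _ _ _ (Ordinal kd)) => /=; first by rewrite prednK.
rewrite mxE /= ifT; last by apply/eqP; lia.
by rewrite prednK.
Qed.

(** As [q] is real and [w^d = 1], frequencies [t] and [d - t] are conjugate; hence a maximum over
    the first half bounds all nonzero frequencies. *)
Lemma idft_rev (q : 'I_d -> R) t : (t <= d)%N -> idft q (d - t) = (idft q t)^*.
Proof.
move=> td; rewrite -(conj_dft q t) conjcK.
apply: eq_bigr => k _; rewrite mulrC; congr (_ * _).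
rewrite mulnBl exprB ?leq_mul2r ?td ?orbT //.
  by rewrite exprM (prim_expr_order (omega_prim_root R d_gt0)) expr1n invf_div
    divr1.
by rewrite unitfE -normr_eq0 -[w]expr1 norm_omegaX oner_eq0.
Qed.

Lemma norm_idft_le_lambda_max (q : 'I_d -> R) t : (0 < t < d)%N ->
  `|idft q t| <= (lambda_max q)%:C.
Proof.
move=> /andP[t0 td]; have [|th] := leqP t d./2.
  by apply: norm_idft_le_half; rewrite t0.
rewrite -normcJ -idft_rev; last exact: ltnW.
apply: norm_idft_le_half; lia.
Qed.

(** In Fourier space each nonzero frequency contributes at most [lambda_max q] times
    [a b <= (a^2 + b^2) / 2], with [a], [b] the moduli of the two transforms; Parseval then returns
    to the sums of squares. *)
Lemma oplus_form_le (q x y : 'I_d -> R) :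
  \sum_k x k = 0 -> \sum_k y k = 0 ->
  \sum_k \sum_l x k * y l * q (oplus k l) <=
    lambda_max q * (\sum_k x k ^+ 2 + \sum_k y k ^+ 2) / 2.
Proof.
move=> x0 y0; set F := \sum_k _; set X := \sum_k _; set Y := \sum_k _.
have d0 : 0 < d%:R :> R by rewrite ltr0n.
have sum_sqr (z : 'I_d -> R) :
    \sum_(t < d) complex.Re `|dft z t| ^+ 2 = d%:R * \sum_k z k ^+ 2.
  apply: complexI; rewrite -dft_parseval // rmorph_sum /=.
  by apply: eq_bigr => t _; rewrite rmorphXn /= -norm_complexR.
suff: d%:R * F <= d%:R * (lambda_max q * (X + Y) / 2) by rewrite ler_pM2l.
apply: le_trans (ler_norm _) _; rewrite -lecR.
have -> : `|d%:R * F|%:C = `|(d%:R * F)%:C|.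
  by rewrite normc_def /= expr0n addr0 sqrtr_sqr.
rewrite dft_convolution //; apply: le_trans (ler_norm_sum _ _ _) _.
have -> : d%:R * (lambda_max q * (X + Y) / 2) = \sum_(t < d)
    lambda_max q * (complex.Re `|dft x t| ^+ 2 + complex.Re `|dft y t| ^+ 2) /
      2.
  by rewrite -mulr_suml -mulr_sumr big_split /= !sum_sqr -/X -/Y; ring.
rewrite rmorph_sum /=; apply: ler_sum => t _.
rewrite !normrM (norm_complexR (dft x t)) (norm_complexR (dft y t)).
set a := complex.Re _; set b := complex.Re _.
have ab : a * b <= (a ^+ 2 + b ^+ 2) / 2 by have := sqr_ge0 (a - b); nra.
(* Frequency 0 has no entry in [N]; its term vanishes because [dft x 0] is the sum of [x]. *)
have [t0|t0] := posnP t.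
  have dft0 : dft x t = 0.
    rewrite /dft t0; under eq_bigr do rewrite mul0n expr0 mulr1.
    by rewrite -rmorph_sum /= x0.
  rewrite /a dft0 normr0 /= mul0r mulr0 ler0c.
  by rewrite divr_ge0 // mulr_ge0 ?lambda_max_ge0 // addr_ge0 ?sqr_ge0.
have a0 : 0 <= a by rewrite -ler0c -norm_complexR.
have b0 : 0 <= b by rewrite -ler0c -norm_complexR.
apply: (@le_trans _ _ ((lambda_max q)%:C * (a * b)%:C)).
  rewrite rmorphM /= ler_wpM2r //; first by rewrite mulr_ge0 ?ler0c.
  by apply: norm_idft_le_lambda_max; rewrite t0 ltn_ord.
rewrite -rmorphM lecR -mulrA; apply: ler_wpM2l => //; exact: lambda_max_ge0.
Qed.
End Spectral.

(** * Hermitian matrices and the Hilbert-Schmidt bound *)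

Section HilbertSchmidt.
Local Open Scope complex_scope.
Variable R : realType.

Lemma Re_sum (I : finType) (F : I -> R[i]) :
  complex.Re (\sum_i F i) = \sum_i complex.Re (F i).
Proof. by apply: big_morph => // -[? ?] [? ?]. Qed.

Lemma Re_realM (a : R) (z : R[i]) : complex.Re (a%:C * z) = a * complex.Re z.
Proof. by case: z => u v /=; rewrite mul0r subr0. Qed.

Lemma ReB (z z' : R[i]) : complex.Re (z - z') = complex.Re z - complex.Re z'.
Proof. by case: z; case: z'. Qed.

Lemma ReD (z z' : R[i]) : complex.Re (z + z') = complex.Re z + complex.Re z'.
Proof. by case: z; case: z'. Qed.

Lemma hermsym_entry n (A : 'M[R[i]]_n) i j :
  A \is hermsymmx -> A j i = (A i j)^*.
Proof.
move=> /is_hermitianmxP; rewrite expr0 scale1r => {1}->.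
by rewrite !mxE.
Qed.

(** For Hermitian [A] the trace is the sum of the squared moduli of the entries. *)
Lemma hermsym_sqr_trace_ge0 n (A : 'M[R[i]]_n) :
  A \is hermsymmx -> 0 <= complex.Re (\tr (A *m A)).
Proof.
move=> Ah; rewrite /mxtrace Re_sum sumr_ge0 // => i _.
rewrite mxE Re_sum sumr_ge0 // => j _.
rewrite (hermsym_entry i j Ah).
by have := mulcJ_ge0 (A i j); rewrite lecE => /andP[].
Qed.

Lemma hermsymB n (A B : 'M[R[i]]_n) :
  A \is hermsymmx -> B \is hermsymmx -> A - B \is hermsymmx.
Proof.
move=> Ah Bh; apply/is_hermitianmxP; rewrite expr0 scale1r.
apply/matrixP => i j; rewrite !mxE (hermsym_entry j i Ah) (hermsym_entry j i
  Bh).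
by rewrite rmorphB.
Qed.

Lemma hermsym_sum n (I : finType) (F : I -> 'M[R[i]]_n) :
  (forall i, F i \is hermsymmx) -> \sum_i F i \is hermsymmx.
Proof.
move=> Fh; apply/is_hermitianmxP; rewrite expr0 scale1r.
apply/matrixP => i j; rewrite mxE mxE !summxE rmorph_sum.
by apply: eq_bigr => k _; apply: hermsym_entry.
Qed.

Lemma hermsym1 n : (1%:M : 'M[R[i]]_n) \is hermsymmx.
Proof. by apply/is_hermitianmxP; rewrite expr0 scale1r trmx1 map_mx1. Qed.

Lemma hermsymZ n (a : R) (A : 'M[R[i]]_n) :
  A \is hermsymmx -> a%:C *: A \is hermsymmx.
Proof.
move=> Ah; apply/is_hermitianmxP; rewrite expr0 scale1r.
apply/matrixP => i j; rewrite !mxE (hermsym_entry j i Ah) rmorphM.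
by congr (_ * _); rewrite [RHS]conjc_real.
Qed.

Lemma hermsym_rank1_proj n (v : 'cV[R[i]]_n) : rank1_proj v \is hermsymmx.
Proof.
apply/is_hermitianmxP; rewrite expr0 scale1r.
apply/matrixP => i j; rewrite !mxE !big_ord1 !mxE rmorphM mulrC.
by congr (_ * _); rewrite [RHS]conjCK.
Qed.

Lemma trace_sqrBB n (A X Y : 'M[R[i]]_n) :
  \tr ((A - X - Y) *m (A - X - Y)) =
    \tr (A *m A) + \tr (X *m X) + \tr (Y *m Y)
    - 2 * \tr (A *m X) - 2 * \tr (A *m Y) + 2 * \tr (X *m Y).
Proof.
have trB (M M' : 'M[R[i]]_n) : \tr (M - M') = \tr M - \tr M'.
  by rewrite mxtraceD -scaleN1r mxtraceZ mulN1r.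
rewrite !mulmxBl !mulmxBr !trB [\tr (X *m A)]mxtrace_mulC.
by rewrite [\tr (Y *m A)]mxtrace_mulC [\tr (Y *m X)]mxtrace_mulC; ring.
Qed.

(** A Bessel-type inequality. With [T] the sum of squares, expanding [tr A^2 >= 0] gives [purity rho
    - 1/n - 2 T / f + tr S^2 / f^2 >= 0], and [tr S^2 <= f T] by the bound on the Gram form [G]. *)
Lemma sum_sqr_le_purity n (I : finType) (P : I -> 'M[R[i]]_n) (x : I -> R)
    (G : I -> I -> R) (f : R) (rho : 'M[R[i]]_n) :
  (0 < n)%N -> rho \is hermsymmx -> \tr rho = 1 ->
  (forall i, P i \is hermsymmx) -> (forall i, \tr (P i) = 1) ->
  (forall i j, \tr (P i *m P j) = (G i j)%:C) ->
  \sum_i x i = 0 ->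
  \sum_i x i * complex.Re (\tr (rho *m P i)) = \sum_i x i ^+ 2 ->
  0 < f -> \sum_i \sum_j x i * x j * G i j <= f * \sum_i x i ^+ 2 ->
  \sum_i x i ^+ 2 <= f * (purity rho - 1 / n%:R).
Proof.
move=> n0 rho_h rho1 P_h P1 PG x0 xP f0 Gf; set T := \sum_i x i ^+ 2 in xP Gf *.
pose S := \sum_i (x i)%:C *: P i.
have S_h : S \is hermsymmx by apply: hermsym_sum => i; apply: hermsymZ.
(* The coefficient [1/f] minimizes [- 2 s T + s^2 f T] over [s]. *)
pose A := rho - n%:R^-1%:C *: 1%:M - f^-1%:C *: S.
have A_h : A \is hermsymmx.
  apply: hermsymB; last exact: hermsymZ.
  by apply: hermsymB => //; apply: hermsymZ; apply: hermsym1.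
have trS : \tr S = 0.
  rewrite /S raddf_sum /=; under eq_bigr do rewrite mxtraceZ P1 mulr1.
  by rewrite -rmorph_sum /= x0.
have trRS : complex.Re (\tr (rho *m S)) = T.
  rewrite /S mulmx_sumr [\tr _]raddf_sum /= Re_sum -xP; apply: eq_bigr => i _.
  by rewrite -scalemxAr mxtraceZ Re_realM.
have trSS : \tr (S *m S) = (\sum_i \sum_j x i * x j * G i j)%:C.
  rewrite /S mulmx_suml raddf_sum /= rmorph_sum /=; apply: eq_bigr => i _.
  rewrite mulmx_sumr raddf_sum /= rmorph_sum /=; apply: eq_bigr => j _.
  by rewrite -scalemxAr -scalemxAl !mxtraceZ PG !rmorphM /=; ring.
have n1 : n%:R != 0 :> R by rewrite pnatr_eq0 -lt0n.
have cN : n%:R^-1%:C * (n%:R^-1%:C * \tr (1%:M : 'M[R[i]]_n)) = n%:R^-1%:C.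
  have -> : \tr (1%:M : 'M[R[i]]_n) = n%:R%:C by rewrite mxtrace1 rmorph_nat.
  by rewrite -!rmorphM mulVf // mulr1.
have trAA : \tr (A *m A) = \tr (rho *m rho) - n%:R^-1%:C
    - f^-1%:C * (2%:C * \tr (rho *m S)) + (f^-1 * f^-1)%:C * \tr (S *m S).
  have -> : 2%:C = 2 :> R[i] by rewrite rmorph_nat.
  have -> : (f^-1 * f^-1)%:C = f^-1%:C * f^-1%:C :> R[i] by rewrite rmorphM.
  rewrite /A.
  move: n%:R^-1%:C f^-1%:C cN => c u cN; rewrite trace_sqrBB.
  rewrite -!scalemxAr -!scalemxAl !mul1mx !mulmx1 !mxtraceZ cN.
  by rewrite trS rho1; ring.
have := hermsym_sqr_trace_ge0 A_h; rewrite trAA trSS -rmorphM.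
rewrite ReD !ReB !Re_realM trRS -/(purity rho).
set g := \sum_i \sum_j _ in Gf *;
  rewrite [complex.Re _%:C]/= [complex.Re (_ * g)%:C]/=.
rewrite div1r; set p := purity rho - n%:R^-1 => h.
have fV0 : 0 < f^-1 by rewrite invr_gt0.
have : f^-1 * f^-1 * g <= f^-1 * T.
  rewrite -mulrA ler_pM2l // -[leRHS](mulKf (lt0r_neq0 f0)).
  by rewrite ler_pM2l.
by move=> Hg; rewrite -ler_pdivrMl //; lra.
Qed.
End HilbertSchmidt.

(** * Orthonormal bases, outcome probabilities and equibiased bases *)

Section Bases.
Local Open Scope complex_scope.
Local Open Scope sesquilinear_scope.
Variables (R : realType) (d : nat).
Implicit Types (rho A : 'M[R[i]]_d) (v : 'cV[R[i]]_d) (e : 'I_d -> 'cV[R[i]]_d).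

Lemma trace_mul_rank1_proj A v :
  \tr (A *m rank1_proj v) = (v^t* *m A *m v) 0 0.
Proof.
by rewrite /rank1_proj mulmxA mxtrace_mulC mulmxA /mxtrace big_ord1.
Qed.

Lemma trace_rank1_proj e k : is_orthonormal_basis e -> \tr (rank1_proj (e k)) =
  1.
Proof.
by move=> eo; rewrite -[rank1_proj _]mul1mx trace_mul_rank1_proj mulmx1 eo eqxx.
Qed.

Lemma trace_rank1_projM e k l : is_orthonormal_basis e ->
  \tr (rank1_proj (e k) *m rank1_proj (e l)) = (k == l)%:R%:C.
Proof.
move=> eo; rewrite trace_mul_rank1_proj /rank1_proj mulmxA -mulmxA.
rewrite mxE big_ord1 !eo rmorph_nat eq_sym.
by case: (k == l); rewrite ?mulr1 ?mulr0.
Qed.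

(** For the square matrix [U] with columns [e k], orthonormality makes the adjoint a left inverse,
    hence also a right inverse, which is the resolution of the identity. *)
Lemma sum_rank1_proj e : is_orthonormal_basis e ->
  \sum_k rank1_proj (e k) = 1%:M.
Proof.
move=> eo; pose U : 'M[R[i]]_d := \matrix_(i, k) e k i 0.
have UU : U^t* *m U = 1%:M.
  apply/matrixP => k l; rewrite !mxE -eo mxE.
  by apply: eq_bigr => i _; rewrite !mxE.
rewrite -(mulmx1C UU); apply/matrixP => i j; rewrite summxE mxE.
by apply: eq_bigr => k _; rewrite !mxE big_ord1 !mxE.
Qed.

Lemma outcome_prob_ge0 rho e j : is_density_matrix rho ->
  0 <= outcome_prob rho e j.
Proof.
move=> [_ rho_ge0 _]; rewrite /outcome_prob trace_mul_rank1_proj.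
by have := rho_ge0 (e j); rewrite lecE => /andP[].
Qed.

Lemma sum_outcome_prob rho e : is_density_matrix rho ->
  is_orthonormal_basis e -> \sum_j outcome_prob rho e j = 1.
Proof.
move=> [_ _ rho1] eo; rewrite -Re_sum.
transitivity (complex.Re (\tr (rho *m \sum_k rank1_proj (e k)))).
  by rewrite mulmx_sumr [\tr _]raddf_sum.
by rewrite sum_rank1_proj // mulmx1 rho1.
Qed.

(** [sum_sqr_le_purity] applied to all projectors at once, indexed by pairs of a basis and an
    outcome, with [f = fL L q]. *)
Lemma MEB_sum_sqr_le L (q : 'I_d -> R) (B : 'I_L -> 'I_d -> 'cV[R[i]]_d) rho :
  (0 < d)%N -> (0 < L)%N -> is_MEB q B -> is_density_matrix rho ->
  \sum_a \sum_j (outcome_prob rho (B a) j - 1 / d%:R) ^+ 2 <=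
    fL L q * (purity rho - 1 / d%:R).
Proof.
move=> d0 L0 [Bo _ Bq] rho_d; have [rho_h _ rho1] := rho_d.
pose x a j := outcome_prob rho (B a) j - 1 / d%:R.
have dN0 : d%:R != 0 :> R by rewrite pnatr_eq0 -lt0n.
have x0 a : \sum_j x a j = 0.
  rewrite sumrB sum_outcome_prob // sumr_const card_ord.
  by rewrite -[_ *+ d]mulr_natr divfK // subrr.
pose G (i j : 'I_L * 'I_d) := complex.Re
  (\tr (rank1_proj (B i.1 i.2) *m rank1_proj (B j.1 j.2))).
pose N a := \sum_j x a j ^+ 2.
have N0 a : 0 <= N a by apply: sumr_ge0 => j _; apply: sqr_ge0.
have lam0 : 0 <= lambda_max q := lambda_max_ge0 q.
have f0 : 0 < fL L q.
  have : 1 <= L%:R :> R by rewrite ler1n.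
  by rewrite /fL; nra.
(* One formula for both cases: for [a = b] the projectors are orthogonal and the right side reduces
   to [N a]; for [a != b] only the first term remains. *)
have cross a b : \sum_k \sum_l x a k * x b l * G (a, k) (b, l) <=
    lambda_max q * (N a + N b) / 2 + (a == b)%:R * (1 - lambda_max q) * N a.
  have [->|ab] := eqVneq a b.
    have -> : \sum_k \sum_l x b k * x b l * G (b, k) (b, l) = N b; last first.
      by rewrite mul1r le_eqVlt; apply/orP; left; apply/eqP; field.
    apply: eq_bigr => k _; rewrite (bigD1 k) //= big1 => [|l lk].
      by rewrite /G trace_rank1_projM //= eqxx addr0 mulr1 expr2.
    by rewrite /G trace_rank1_projM //= eq_sym (negPf lk) mulr0.
  have [s [_ sE]] := Bq a b ab.
  (* Relabelling both vectors by the inverse of [s] turns [q (oplus (s k) (s l))] into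
     [q (oplus k l)] without changing sums or sums of squares. *)
  pose y c k := x c (s^-1 k)%g.
  have yE c (F : R -> R) : \sum_k F (y c k) = \sum_k F (x c k).
    by rewrite (reindex_inj (@perm_inj _ s)); apply: eq_bigr => k _;
      rewrite /y permK.
  have y0 c : \sum_k y c k = 0 by rewrite (yE c id).
  have := oplus_form_le d0 q (y0 a) (y0 b).
  have yN c : \sum_k y c k ^+ 2 = N c := yE c (fun z => z ^+ 2).
  rewrite !yN !mul0r addr0; apply: le_trans; rewrite le_eqVlt; apply/orP; left;
    apply/eqP.
  rewrite [RHS](reindex_inj (@perm_inj _ s)); apply: eq_bigr => k _.
  rewrite [RHS](reindex_inj (@perm_inj _ s)); apply: eq_bigr => l _.
  by rewrite /G sE /y !permK.
have pairE (F : 'I_L -> 'I_d -> R) : \sum_(i : 'I_L * 'I_d) F i.1 i.2 = \sum_a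
  \sum_j F a j.
  by rewrite pair_bigA.
have TE : \sum_(i : 'I_L * 'I_d) x i.1 i.2 ^+ 2 = \sum_a N a.
  exact: (pairE (fun a j => x a j ^+ 2)).
rewrite -[leLHS](pairE (fun a j => x a j ^+ 2)).
apply: (@sum_sqr_le_purity R d _ (fun i => rank1_proj (B i.1 i.2)) _ G) => //.
- by move=> i; apply: hermsym_rank1_proj.
- by move=> i; apply: trace_rank1_proj.
- move=> [a k] [b l]; rewrite /G /=; have [->|ab] := eqVneq a b.
    by rewrite trace_rank1_projM.
  by have [s [_ ->]] := Bq a b ab.
- by rewrite (pairE x) big1.
- rewrite (pairE (fun a j => x a j * outcome_prob rho (B a) j)) TE.
  apply: eq_bigr => a _; rewrite /N.
  have -> : \sum_j x a j * outcome_prob rho (B a) j =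
      \sum_j (x a j ^+ 2 + x a j * (1 / d%:R)).
    by apply: eq_bigr => j _; rewrite /x; ring.
  by rewrite big_split /= -mulr_suml x0 mul0r addr0.
- rewrite TE.
  have -> : \sum_i \sum_j x i.1 i.2 * x j.1 j.2 * G i j =
      \sum_a \sum_b \sum_k \sum_l x a k * x b l * G (a, k) (b, l).
    transitivity (\sum_a \sum_k \sum_b \sum_l x a k * x b l * G (a, k) (b, l)).
      rewrite [RHS]pair_bigA /=; apply: eq_bigr => -[a k] _ /=.
      by rewrite [RHS]pair_bigA /=; apply: eq_bigr => -[b l] _.
    by apply: eq_bigr => a _; rewrite exchange_big.
  (* Writing [T] for the sum of all [N a], the bounds of [cross] total
     [lambda_max q L T + (1 - lambda_max q) T], which is [fL L q] times [T]. *)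
  apply: (@le_trans _ _ (\sum_a (lambda_max q * (L%:R * N a + \sum_b N b) / 2
      + (1 - lambda_max q) * N a))).
    apply: ler_sum => a _; apply: le_trans (ler_sum _ (fun b _ => cross a b)) _.
    rewrite big_split /= -mulr_suml -mulr_sumr big_split /= sumr_const card_ord.
    rewrite [X in _ + X](bigD1 a) //= eqxx mul1r [X in _ + (_ + X)]big1 ?addr0
      ?mulr_natl //.
    by move=> b ba; rewrite eq_sym (negPf ba) !mul0r.
  rewrite big_split /= -mulr_sumr -mulr_suml -mulr_sumr big_split /= -mulr_sumr.
  rewrite sumr_const card_ord -mulr_natl /fL.
  by rewrite le_eqVlt; apply/orP; left; apply/eqP; field.
Qed.
End Bases.

(** * The entropic uncertainty relation *)

Theorem theorem5 (R : realType) (d L : nat) (hd : (2 <= d)%N) (hL : (2 <= L)%N)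
    (q : 'I_d -> R) (hq : is_prob_distr q)
    (B : 'I_L -> 'I_d -> 'cV[complex R]_d) (hB : is_MEB q B)
    (hlam : lambda_max q < 1 / (L%:R - 1))
    (rho : 'M[complex R]_d) (hrho : is_density_matrix rho) :
  let C : R := fL L q * (purity rho - 1 / d%:R) + L%:R / d%:R in
  let K : R := (Num.floor (L%:R / C))%:~R in
  \sum_(a < L) shannon_entropy (outcome_prob rho (B a)) >=
    (L%:R - K * C) * (K + 1) * ln (K + 1)
    - (L%:R - (K + 1) * C) * K * ln K.
Proof.
rewrite /=; set C := fL L q * _ + _; set K := (Num.floor _)%:~R.
have d0 : (0 < d)%N by apply: leq_trans hd.
have L0 : (0 < L)%N by apply: leq_trans hL.
have dR : 0 < d%:R :> R by rewrite ltr0n.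
have LR : 0 < L%:R :> R by rewrite ltr0n.
have [Bo _ _] := hB.
pose p a j := outcome_prob rho (B a) j.
have p0 a j : 0 <= p a j by apply: outcome_prob_ge0.
have p1 a : \sum_j p a j = 1 by apply: sum_outcome_prob.
have TC := MEB_sum_sqr_le d0 L0 hB hrho.
have C0 : 0 < C.
  rewrite /C ltr_wpDl ?divr_gt0 //; apply: le_trans TC.
  by apply: sumr_ge0 => a _; apply: sumr_ge0 => j _; apply: sqr_ge0.
have : 0 <= Num.floor (L%:R / C) by rewrite floor_ge0 divr_ge0 // ltW.
rewrite /K; case: (Num.floor _) => // n _; rewrite -pmulrn {K}.
(* For [K = 0] the right side is 0, and each entropy is nonnegative. *)
case: n => [|n].
  rewrite add0r ln1 !(mulr0, mul0r) subr0; apply: sumr_ge0 => a _.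
  rewrite /shannon_entropy -sumrN; apply: sumr_ge0 => j _.
  apply: negxlnx_ge0; rewrite p0 /= -(p1 a) (bigD1 j) //= lerDl.
  by apply: sumr_ge0 => i _; apply: p0.
(* Centering at [1/d] lowers each index of coincidence by [1/d], which accounts for the summand
   [L/d] of [C]. *)
have coincidence : \sum_a \sum_j p a j ^+ 2 <= C.
  have pE a : \sum_j (p a j - 1 / d%:R) ^+ 2 = \sum_j p a j ^+ 2 - 1 / d%:R.
    have -> : \sum_j (p a j - 1 / d%:R) ^+ 2 =
        \sum_j (p a j ^+ 2 - 2 / d%:R * p a j + 1 / d%:R ^+ 2).
      by apply: eq_bigr => j _; field; rewrite gt_eqF.
    rewrite big_split sumrB /= -mulr_sumr p1 sumr_const card_ord -mulr_natl.
    by field; rewrite gt_eqF.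
  move: TC; under eq_bigr do rewrite pE.
  by rewrite sumrB sumr_const card_ord -mulr_natl /C; lra.
have nE : n.+2%:R = n.+1%:R + 1 :> R by rewrite natr1.
have H a := @shannon_entropy_ge_coincidence R d n.+1 (p a) isT (p0 a) (p1 a).
apply: le_trans (ler_sum _ (fun a _ => H a)).
rewrite sumrB -mulr_sumr sumr_const card_ord -mulr_natl -nE.
set k := n.+1%:R : R; set k1 := n.+2%:R; set S := \sum_a _ in coincidence *.
have b0 : 0 <= k * k1 * (ln k1 - ln k).
  by rewrite !mulr_ge0 // subr_ge0 ler_ln ?posrE ?ltr0n // ler_nat.
(* The total index of coincidence enters with a nonpositive coefficient, so it may be replaced by
   its bound [C]; collecting the two logarithms gives the stated form. *)
have := ler_wpM2l b0 coincidence.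
rewrite /k1 nE -/k; lra.
Qed.
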